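(* For every $\epsilon>0$ there exists a graph $G$ with $n=n(\epsilon)$ vertices such that $G$ has no $\delta_k$-obstacle representation for any integer $k\ge 2$ with $k<n^{1-\epsilon}$.
   Context: Graphs are finite, simple and undirected. For an integer $k\ge 2$ let $N_k=\{v_i=(\cos(i\pi/k),\sin(i\pi/k)) : i\in\{0,\dots,2k-1\}\}$ and let $\delta_k(p,q)=\min\{\sum_i |a_i| : q-p=\sum_i a_i v_i\}$ for $p,q\in\mathbb{R}^2$; its unit ball is a regular $2k$-gon. For $x\in\mathbb{R}^2$ and $i\in\{0,\dots,2k-1\}$ the $i$-sector of $x$ is the closed cone $Q^k_i(x)=x+\{r(\cos\theta,\sin\theta): r\ge 0,\ i\pi/k\le\theta\le (i+1)\pi/k\}$ (the cone spanned by one facet of the $2k$-gon, translated to $x$). A curve is a continuous map $f:[0,1]\to\mathbb{R}^2$ with endpoints $f(0),f(1)$ and image $f([0,1])$. A curve $f$ is $\delta_k$-monotone if for some $i$ we have $f(b)\in Q^k_i(f(a))$ for all $0\le a\le b\le 1$. The geodesics for $\delta_k$ are the $\delta_k$-monotone curves. A $\delta_k$-obstacle representation of a graph $G$ is a pair $(\varphi,S)$, where $\varphi:V(G)\to\mathbb{R}^2$ is injective and $S$ is a set of connected subsets of $\mathbb{R}^2$ (obstacles), such that for all distinct $u,w\in V(G)$: $uw\in E(G)$ if and only if there is a geodesic for $\delta_k$ with endpoints $\varphi(u)$ and $\varphi(w)$ whose image is disjoint from $\bigcup S$. *)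

(* Defs.v *)
From HB Require Import structures.
From mathcomp Require Import all_boot all_order all_algebra.
From mathcomp Require Import all_classical all_reals all_analysis.

Set Implicit Arguments.
Unset Strict Implicit.
Unset Printing Implicit Defensive.

Import Order.TTheory GRing.Theory Num.Theory.
Import numFieldNormedType.Exports.

Local Open Scope classical_set_scope.
Local Open Scope ring_scope.

Section GeodesicObstacles.
Context {R : realType}.
Implicit Types (k i : nat) (x : R * R) (f : R -> R * R).

Definition sector k i x : set (R * R) :=
  [set y | exists r t : R,
    [/\ 0 <= r,
        i%:R * pi / k%:R <= t <= i.+1%:R * pi / k%:R &
        y = (x.1 + r * cos t, x.2 + r * sin t)]].

(* A curve is a total function on R of which only the restriction to [0, 1]
   matters. *)
Definition curve f : Prop := {within `[0, 1], continuous f}.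

Definition curve_image f : set (R * R) := f @` `[0, 1].

Definition monotone_curve k f : Prop :=
  curve f /\
  exists i : 'I_(2 * k),
    forall a b : R, 0 <= a -> a <= b -> b <= 1 -> sector k i (f a) (f b).

(* The polygonal distance delta_k, whose unit ball is the regular 2k-gon with
   vertices (cos (i pi / k), sin (i pi / k)), plays a role only through its
   geodesics; by convention these are the delta_k-monotone curves. *)
Definition geodesic k f : Prop := monotone_curve k f.

(* Quantifying over ordered pairs (u, w) while fixing the direction
   of the curve loses nothing: reversing a curve that is monotone for the
   sector i gives one that is monotone for the opposite sector. *)
Definition obstacle_representation k (V : finType) (E : rel V)
    (phi : V -> R * R) (S : set (set (R * R))) : Prop :=
  [/\ injective phi,
      forall O, S O -> connected O &
      forall u w : V, u != w ->
        (E u w <->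
         exists f, [/\ geodesic k f, f 0 = phi u, f 1 = phi w &
                       curve_image f `&` \bigcup_(O in S) O = set0])].

End GeodesicObstacles.

Definition has_obstacle_representation (R : realType) k
    (V : finType) (E : rel V) : Prop :=
  exists (phi : V -> R * R) (S : set (set (R * R))),
    obstacle_representation k E phi S.

(* Main.v *)
(** Rotate the plane so that sector [i] becomes the cone [|dt| <= c * ds]. The
geodesics of that class are then graphs of [c]-Lipschitz functions of [s], and
if two of them, from [u] to [w] and from [u'] to [w'], meet, then by exchanging
tails there are also geodesics from [u] to [w'] and from [u'] to [w].

This makes each class sparse, unless it contains a complete bipartite graph
[K_(t,t)]. Take the paths crossing a vertical line, sorted by height, and cut
the sequence into blocks of [4 t^2]. If there are too many paths, some block
contains none of the first and last [t] paths at any vertex. In this block at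
least [2 t] endpoints on one side of the line differ, say on the left; let [x]
be the one closest to the line. At the level of [x], a path of the block passes
below or above [x]; in the first case it meets all paths from [x] that are lower
on the line, hence it reaches their [t] ends. At least [t] left endpoints of the
block fall in the same case, which gives [K_(t,t)]. Halving the vertex set
recursively, a class without [K_(t,t)] has [O(t^3 n log n)] pairs.

By counting, for [n = 2^p] and [t = 2 p + 2] there is a graph such that neither
it nor its complement contains [K_(t,t)]; the denser of the two has at least
[n (n - 1) / 4] edges and hence needs about [n / polylog n] classes. *)

Require Import Defs.
From mathcomp Require Import all_boot all_order all_algebra.
From mathcomp Require Import all_classical all_reals all_analysis.
From mathcomp Require Import lra ring zify.

Set Implicit Arguments.
Unset Strict Implicit.
Unset Printing Implicit Defensive.

Import Order.TTheory GRing.Theory Num.Theory.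
Import numFieldNormedType.Exports.
Local Open Scope ring_scope.

(** * Sectors and monotone curves *)

Section Sectors.
Local Open Scope classical_set_scope.
Local Open Scope ring_scope.
Context {R : realType}.
Implicit Types (a b c r s t : R) (p q : R * R).

Lemma tan_homo_le a b : - (pi / 2) < a -> a <= b -> b < pi / 2 -> tan a <= tan b.
Proof.
move=> a0; rewrite le_eqVlt => /predU1P[->//|ab] b0; apply: ltW.
rewrite ltr_tan// in_itv/= ?a0 ?b0 ?andbT; first exact: lt_trans ab b0.
exact: lt_trans a0 ab.
Qed.

(** As [b < pi / 2], all cosines involved are positive and the bound on the angle becomes one on its
    tangent; conversely the angle is [atan (x.2 / x.1)]. *)
Lemma polar_cone b (x : R * R) : 0 < b < pi / 2 ->
  (exists r t, [/\ 0 <= r, `|t| <= b & x = (r * cos t, r * sin t)]) <->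
  `|x.2| <= tan b * x.1.
Proof.
move=> /andP[b0 bpi]; split.
  move=> [r [t [r0 tb ->]]] /=; move: tb; rewrite ler_norml => /andP[tb1 tb2].
  have ct : 0 < cos t.
    by apply: cos_gt0_pihalf; rewrite (lt_le_trans _ tb1) ?ltrN2// (le_lt_trans tb2).
  have -> : sin t = tan t * cos t by rewrite /tan mulfVK ?gt_eqF.
  rewrite mulrCA normrM (@ger0_norm _ (r * cos t)) ?mulr_ge0 ?(ltW ct)//.
  apply: ler_wpM2r; first by rewrite mulr_ge0 ?(ltW ct).
  rewrite ler_norml -tanN !tan_homo_le ?ltrN2//.
    by rewrite (lt_le_trans _ tb1) ?ltrN2.
  by rewrite (le_lt_trans tb2).
case: x => x1 x2 /= h.
have cb : 0 < cos b by apply: cos_gt0_pihalf; rewrite bpi andbT; lra.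
have sb : 0 < sin b by apply: sin_gt0_pihalf; rewrite b0.
have tb : 0 < tan b by rewrite divr_gt0.
have x10 : 0 <= x1 by rewrite -(pmulr_rge0 _ tb) (le_trans _ h).
have [x1E|x1N] := eqVneq x1 0.
  exists 0, 0; split => //; first by rewrite normr0 ltW.
  by move: h; rewrite x1E mulr0 normr_le0 !mul0r => /eqP ->.
have x1p : 0 < x1 by rewrite lt_def x1N.
pose t := atan (x2 / x1).
have ct : 0 < cos t by apply: cos_gt0_pihalf; rewrite atan_gtNpi2 atan_ltpi2.
exists (x1 / cos t), t; split.
- by rewrite divr_ge0 // ltW.
- have bK : atan (tan b) = b by apply: tanK; rewrite in_itv/= bpi andbT; lra.
  move: h; rewrite -ler_pdivrMr// -[x1 in `|_| / x1](gtr0_norm x1p) -normf_div.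
  rewrite !ler_norml => /andP[h1 h2]; rewrite -bK -atanN.
  by apply/andP; split; apply: le_atan.
- have cN : cos t != 0 by rewrite gt_eqF.
  congr (_, _); first by rewrite mulfVK.
  by rewrite mulrAC -mulrA -/(tan t) atanK mulrC mulfVK.
Qed.

(** Rotation by [- a]: the direction [a] becomes the first axis. *)
Definition rotate a p : R * R :=
  (p.1 * cos a + p.2 * sin a, p.2 * cos a - p.1 * sin a).

Lemma rotateK a : cancel (rotate a) (rotate (- a)).
Proof.
move=> [x y]; rewrite /rotate /= cosN sinN; have := cos2Dsin2 a => h.
congr (_, _).
  rewrite [RHS](_ : x = x * (cos a ^+ 2 + sin a ^+ 2)); first ring.
  by rewrite h mulr1.
rewrite [RHS](_ : y = y * (cos a ^+ 2 + sin a ^+ 2)); first ring.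
by rewrite h mulr1.
Qed.

(** Direction of the bisector of sector [i], which extends by [half_angle k] to either side. *)
Definition sector_axis k i : R := (i%:R + 2^-1) * pi / k%:R.

Definition half_angle k : R := pi / 2 / k%:R.

Definition sector_slope k : R := tan (half_angle k).

Lemma half_angle_bounds k : (1 < k)%N -> 0 < half_angle k < pi / 2.
Proof.
move=> k1; have k0 : (0 : R) < k%:R by rewrite ltr0n ltnW.
have pi0 : 0 < pi / 2 :> R by rewrite divr_gt0 ?pi_gt0.
by rewrite divr_gt0//= ltr_pdivrMr// ltr_pMr// ltr1n.
Qed.

Lemma sector_slope_gt0 k : (1 < k)%N -> 0 < sector_slope k.
Proof.
move=> /half_angle_bounds/andP[b0 b1].
rewrite divr_gt0 ?sin_gt0_pihalf ?b0// cos_gt0_pihalf// b1 andbT.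
by rewrite (lt_trans _ b0)// oppr_lt0 (lt_trans b0).
Qed.

(** Measured from its bisector, a sector is a symmetric cone, to which [polar_cone] applies.
    Monotonicity thus becomes a Lipschitz inequality between the rotated coordinates. *)
Lemma sector_rotate k i (x y : R * R) : (1 < k)%N ->
  sector k i x y <->
  `|(rotate (sector_axis k i) y).2 - (rotate (sector_axis k i) x).2|
  <= sector_slope k * ((rotate (sector_axis k i) y).1
                     - (rotate (sector_axis k i) x).1).
Proof.
move=> k1; have b0 := half_angle_bounds k1.
set a := sector_axis k i; set b := half_angle k in b0.
have kN : k%:R != 0 :> R by rewrite pnatr_eq0; lia.
have lo : i%:R * pi / k%:R = a - b :> R.
  by rewrite /a /sector_axis /b /half_angle; field.
have hi : i.+1%:R * pi / k%:R = a + b :> R.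
  by rewrite /a /sector_axis /b /half_angle -natr1; field.
have := polar_cone ((rotate a y).1 - (rotate a x).1,
                    (rotate a y).2 - (rotate a x).2) b0.
move=> /= <-; rewrite /sector /= lo hi; clear -R.
have h := cos2Dsin2 a; split.
  move=> [r [t [r0 /andP[t1 t2] ->]]]; exists r, (t - a); split => //=.
    by rewrite ler_norml; apply/andP; split; lra.
  rewrite /rotate/= cosB sinB; congr (_, _); ring.
move=> [r [t [r0 tb [e1 e2]]]]; exists r, (t + a); split => //=.
  by move: tb; rewrite ler_norml => /andP[t1 t2]; apply/andP; split; lra.
case: x y e1 e2 => [x1 x2] [y1 y2] /= e1 e2; congr (_, _).
  rewrite cosD mulrBr !mulrA -e1 -e2.
  by rewrite -[LHS](subrKC x1) -[y1 - x1]mulr1 -h; congr (_ + _); ring.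
rewrite sinD mulrDr !mulrA -e1 -e2.
by rewrite -[LHS](subrKC x2) -[y2 - x2]mulr1 -h; congr (_ + _); ring.
Qed.


(** * Monotone curves as graphs of Lipschitz functions *)

Lemma rotate_continuous a : continuous (rotate a).
Proof.
have c1 : continuous (fun p => p.1 * cos a + p.2 * sin a).
  by move=> p; apply: cvgD; apply: cvgMl; [exact: cvg_fst|exact: cvg_snd].
have c2 : continuous (fun p => p.2 * cos a - p.1 * sin a).
  by move=> p; apply: cvgB; apply: cvgMl; [exact: cvg_snd|exact: cvg_fst].
by move=> p; exact: (cvg_pair (c1 p) (c2 p)).
Qed.

(** Only the part of the graph over [[p.1, q.1]] has to stay in [F], but [g] is Lipschitz on the
    whole line, so that gluing needs no care about domains. *)
Definition graph_path c (F : set (R * R)) p q (g : R -> R) : Prop :=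
  [/\ p.1 <= q.1, forall s t, `|g s - g t| <= c * `|s - t|,
      g p.1 = p.2, g q.1 = q.2 &
      forall s, p.1 <= s <= q.1 -> F (s, g s)].

Definition reach c F p q : Prop := exists g, graph_path c F p q g.

Lemma lipschitz_continuous c (g : R -> R) :
  (forall s t, `|g s - g t| <= c * `|s - t|) -> continuous g.
Proof.
move=> gL x; apply/cvgrPdist_lt => e e0.
have c0 : 0 < `|c| + 1 by rewrite ltr_wpDl.
near=> y; apply: (le_lt_trans (gL _ _)).
apply: (@le_lt_trans _ _ ((`|c| + 1) * `|x - y|)).
  by apply: ler_wpM2r => //; rewrite (le_trans (ler_norm c))// lerDl.
rewrite -ltr_pdivlMl//.
near: y; apply: cvgr_dist_lt; rewrite ?mulr_gt0 ?invr_gt0//.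
Unshelve. all: by end_near. Qed.

(** [g - g'] changes sign between [s] and [t], so the graphs meet above some [r]. Following [g] up
    to [r] and [g'] afterwards keeps the constant [c], by the triangle inequality through the
    meeting point. *)
Lemma reach_cross c F p q p' q' g g' s t :
  graph_path c F p q g -> graph_path c F p' q' g' ->
  p.1 <= s <= q.1 -> p'.1 <= s <= q'.1 ->
  p.1 <= t <= q.1 -> p'.1 <= t <= q'.1 ->
  g s <= g' s -> g' t <= g t -> reach c F p q'.
Proof.
move=> [pq gL gp gq gF] [pq' gL' gp' gq' gF'] s1 s2 t1 t2 gs gt.
have [r r1 [r2 gr]] : exists2 r, p.1 <= r <= q.1 & p'.1 <= r <= q'.1 /\ g r = g' r.
  have dc : continuous (g \- g').
    by move=> x; apply: cvgB; apply: lipschitz_continuous; eassumption.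
  have key a b : a <= b -> Num.min ((g \- g') a) ((g \- g') b) <= 0 <=
      Num.max ((g \- g') a) ((g \- g') b) -> exists2 r, a <= r <= b & g r = g' r.
    move=> ab h; have [|r rab /eqP] := IVT ab _ h; first exact: continuous_subspaceT.
    by rewrite /= subr_eq0 => /eqP ?; exists r => //; move: rab; rewrite in_itv.
  have [st|ts] := leP s t.
    have [|r rst gr] := key _ _ st.
      by rewrite ge_min le_max /= !subr_le0 !subr_ge0 gs gt orbT.
    by exists r => //; [lra|split => //; lra].
  have [|r rst gr] := key _ _ (ltW ts).
    by rewrite ge_min le_max /= !subr_le0 !subr_ge0 gs gt orbT.
  by exists r => //; [lra|split => //; lra].
exists (fun x => if x <= r then g x else g' x); split.
- lra.
- have key x y : x <= r -> r < y -> `|g x - g' y| <= c * `|x - y|.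
    move=> xr ry; rewrite -(subrKA (g r)) [X in _ + (X - _)]gr.
    rewrite (le_trans (ler_normD _ _))// (le_trans (lerD (gL x r) (gL' r y)))//.
    by rewrite -mulrDr !ler0_norm; lra.
  move=> x y; case: (leP x r) => xr; case: (leP y r) => yr //; first exact: key.
  by rewrite distrC (distrC x); exact: key.
- by case/andP: r1 => -> _.
- case: (leP q'.1 r) => // q'r; have -> : q'.1 = r by lra.
  by rewrite gr; have <- : q'.1 = r by lra.
- move=> x xb; case: (leP x r) => xr; first by apply: gF; lra.
  by apply: gF'; lra.
Qed.

Definition free_region k i (B : set (R * R)) : set (R * R) :=
  [set z | ~ B (rotate (- sector_axis k i) z)].

(** Along the curve the first rotated coordinate is continuous and nondecreasing, and equal first
    coordinates force equal second ones. Hence the image is a graph, even if the curve rests. *)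
Lemma monotone_reach k i B f : (1 < k)%N -> curve f ->
  (forall a b, 0 <= a -> a <= b -> b <= 1 -> sector k i (f a) (f b)) ->
  curve_image f `&` B = set0 ->
  reach (sector_slope k) (free_region k i B)
    (rotate (sector_axis k i) (f 0)) (rotate (sector_axis k i) (f 1)).
Proof.
move=> k1 fc fm fB; set al := sector_axis k i.
have {}fm a b : 0 <= a -> a <= b -> b <= 1 ->
    `|(rotate al (f b)).2 - (rotate al (f a)).2| <=
    sector_slope k * ((rotate al (f b)).1 - (rotate al (f a)).1).
  by move=> a0 ab b1; apply/sector_rotate => //; exact: fm.
have sl0 := sector_slope_gt0 k1.
set s := fun a => (rotate al (f a)).1.
set t := fun a => (rotate al (f a)).2.
have sm a b : 0 <= a -> a <= b -> b <= 1 -> s a <= s b.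
  move=> a0 ab b1; rewrite -subr_ge0 -(pmulr_rge0 _ sl0).
  by apply: le_trans (fm a b a0 ab b1).
have s01 : s 0 <= s 1 by apply: sm.
have sc : {within `[0, 1], continuous s}.
  have rc : continuous (fun p => (rotate al p).1).
    move=> p; apply: (@continuous_comp _ _ _ (rotate al) fst); last exact: cvg_fst.
    exact: rotate_continuous.
  by rewrite /curve in fc => x; apply: (continuous_comp (fc x) (rc (f x))).
(* Composing with this 1-Lipschitz retraction onto [[s 0, s 1]] extends the function to the whole
   line. *)
pose clamp x := Num.max (s 0) (Num.min (s 1) x).
have clampP x : s 0 <= clamp x <= s 1.
  by rewrite /clamp le_max lexx /= ge_max s01 ge_min lexx.
have clampE x : s 0 <= x <= s 1 -> clamp x = x.
  by move=> /andP[x0 x1]; rewrite /clamp min_r// max_r.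
have clampL x y : `|clamp x - clamp y| <= `|x - y|.
  wlog xy : x y / x <= y => [H|].
    by have [/H//|/ltW/H] := leP x y; rewrite distrC (distrC y).
  rewrite (@ler0_norm _ (x - y)) ?subr_le0// /clamp.
  rewrite ler_norml.
  case: (leP (s 1) x) => ?; case: (leP (s 1) y) => ?; rewrite ?(max_r s01);
    case: (leP (s 0) x) => ?; case: (leP (s 0) y) => ?; lra.
have /choice[h hP] : forall x, exists a, 0 <= a <= 1 /\ s a = clamp x.
  move=> x; have [|a a01 sa] := @IVT R s 0 1 (clamp x) ler01 sc.
    by rewrite min_l// max_r.
  by exists a; move: a01; rewrite in_itv.
have tL a b : 0 <= a <= 1 -> 0 <= b <= 1 -> `|t a - t b| <= sector_slope k * `|s a - s b|.
  wlog ab : a b / a <= b => [H|].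
    have [/H//|/ltW ba a01 b01] := leP a b.
    by rewrite distrC (distrC (s a)); apply: H.
  move=> /andP[a0 a1] /andP[b0 b1]; rewrite distrC (distrC (s a)).
  by rewrite (@ger0_norm _ (s b - s a)) ?subr_ge0 ?sm// fm.
have tE a b : 0 <= a <= 1 -> 0 <= b <= 1 -> s a = s b -> t a = t b.
  move=> a01 b01 sab; apply/eqP; rewrite -subr_eq0 -normr_le0.
  by rewrite (le_trans (tL _ _ a01 b01))// sab subrr normr0 mulr0.
have i0 : (0 <= 0 :> R) && (0 <= 1 :> R) by rewrite lexx ler01.
have i1 : (0 <= 1 :> R) && (1 <= 1 :> R) by rewrite lexx ler01.
exists (t \o h); split => //=.
- move=> x y; have [hx ex] := hP x; have [hy ey] := hP y.
  rewrite (le_trans (tL _ _ hx hy))// ex ey ler_pM2l//.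
- have [hx ex] := hP (s 0); apply: (tE _ _ hx i0).
  by rewrite ex clampE// lexx.
- have [hx ex] := hP (s 1); apply: (tE _ _ hx i1).
  by rewrite ex clampE// lexx andbT.
- move=> x xs; have [hx ex] := hP x; rewrite /free_region /=.
  rewrite -{1}(clampE _ xs) -ex -surjective_pairing rotateK => Bx.
  suff : (curve_image f `&` B) (f (h x)) by rewrite fB.
  by split => //; exists (h x) => //=; rewrite in_itv.
Qed.

(** Traverse the graph at constant speed in the first coordinate; the Lipschitz bound is then
    monotonicity. *)
Lemma reach_monotone k i B p q : (1 < k)%N ->
  reach (sector_slope k) (free_region k i B)
    (rotate (sector_axis k i) p) (rotate (sector_axis k i) q) ->
  exists f, [/\ curve f,
    forall a b, 0 <= a -> a <= b -> b <= 1 -> sector k i (f a) (f b),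
    f 0 = p, f 1 = q & curve_image f `&` B = set0].
Proof.
move=> k1 [g]; set al := sector_axis k i.
set P := rotate al p; set Q := rotate al q => -[PQ gL gP gQ gF].
pose l x := P.1 + x * (Q.1 - P.1).
have NK z : rotate al (rotate (- al) z) = z by rewrite -{1}[al]opprK rotateK.
exists (fun x => rotate (- al) (l x, g (l x))); split.
- apply: continuous_subspaceT => x.
  apply: (@continuous_comp _ _ _ (fun x => (l x, g (l x))) (rotate (- al)));
    last exact: rotate_continuous.
  have lc : {for x, continuous l}.
    by apply: cvgD; [exact: cvg_cst|apply: cvgMl; exact: cvg_id].
  have gc : {for x, continuous (g \o l)}.
    by apply: continuous_comp; [exact: lc|exact: (lipschitz_continuous gL)].
  exact: (cvg_pair lc gc).
- move=> a b a0 ab b1; apply/sector_rotate => //; rewrite -/al !NK /=.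
  have lab : l a <= l b by rewrite lerD2l ler_wpM2r// subr_ge0.
  by rewrite (le_trans (gL _ _))// ger0_norm ?subr_ge0.
- by rewrite /l mul0r addr0 gP -surjective_pairing rotateK.
- by rewrite /l mul1r addrC subrK gQ -surjective_pairing rotateK.
- rewrite -subset0 => z [[x]] /=; rewrite in_itv /= => /andP[x0 x1] <-.
  apply: gF; rewrite /l lerDl mulr_ge0 ?subr_ge0//=.
  by rewrite -lerBrDl ler_piMl// subr_ge0.
Qed.

End Sectors.

(** * Pairs of points joined across a line *)

Section Grids.
Local Open Scope nat_scope.
Context {d0 : Order.disp_t} {O : orderType d0} {V : finType}.
Implicit Types (rel : V -> V -> bool) (t m q : nat).

(** A copy of [K_(t,t)], directed from [A] to [B] because reachability is directed; pairs inside [A]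
    or inside [B] are unrestricted. *)
Definition grid rel t : Prop := exists A B : {set V},
  [/\ [disjoint A & B], t <= #|A|, t <= #|B| &
      forall a b, a \in A -> b \in B -> rel a b].

(** An index with few predecessors of its colour is determined by the colour and the number of these
    predecessors. The rank [r] covers both the order of the indices and its reverse. *)
Lemma card_few_before m (c : 'I_m -> V) (C : {set V}) (r : 'I_m -> nat) t :
  (forall j, c j \in C) -> injective r ->
  #|[set j | #|[set i | (r i < r j) && (c i == c j)]| < t]| <= #|C| * t.
Proof.
case: t => [|t] cC rI.
  by rewrite (_ : [set _ | _] = finset.set0) ?cards0//.
pose before j := [set i | (r i < r j) && (c i == c j)].
pose X := [set j | #|before j| < t.+1]; rewrite -/X.
pose f j : V * 'I_t.+1 := (c j, inord #|before j|).
have mono j j' : c j = c j' -> r j < r j' -> #|before j| < #|before j'|.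
  move=> cj rj; apply: proper_card; apply/properP; split.
    apply/fintype.subsetP => i; rewrite !inE cj => /andP[ri ->].
    by rewrite (ltn_trans ri rj).
  by exists j; rewrite !inE ?rj ?cj ?eqxx ?ltnn.
have fI : {in X &, injective f}.
  move=> j j'; rewrite !inE => jX j'X [cj /(congr1 val)].
  rewrite /= !inordK// => bj; apply: rI; apply/eqP.
  case: ltngtP => // rj.
    by have := mono _ _ cj rj; rewrite bj ltnn.
  by have := mono _ _ (esym cj) rj; rewrite bj ltnn.
have -> : #|C| * t.+1 = #|finset.setX C [set: 'I_t.+1]| by rewrite cardsX cardsT card_ord.
rewrite -(card_in_imset fI).
by apply: subset_leq_card; apply/fintype.subsetP => _ /imsetP[j _ ->]; rewrite !inE cC.
Qed.

Definition repeated m (c : 'I_m -> V) t (j : 'I_m) : Prop :=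
  t <= #|[set i : 'I_m | (i < j) && (c i == c j)]| /\
  t <= #|[set i : 'I_m | (j < i) && (c i == c j)]|.

(** The disjunction abstracts planarity: at the level of [c j], path [i] passes below or above this
    point, hence meets all paths from it that rank lower or higher. It is applied to the point [x]
    with the largest [s] in the window [W]. *)
Lemma window_grid rel m (c d : 'I_m -> V) (s : V -> O) (W : {set 'I_m}) t :
  (forall i j, c i = c j -> d i = d j -> i = j) ->
  (forall i j, c i != d j) ->
  (forall i j k : 'I_m, i \in W -> k \in W -> i <= j <= k -> j \in W) ->
  (forall j, j \in W -> repeated c t j) ->
  (forall i j, (s (c i) <= s (c j))%O ->
    (forall j', c j' = c j -> j' <= i -> rel (c i) (d j')) \/
    (forall j', c j' = c j -> i <= j' -> rel (c i) (d j'))) ->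
  0 < t -> t.*2 <= #|c @: W| -> grid rel t.
Proof.
move=> cdI cd Wc Wr sep t0 cW.
have /card_gt0P[x0 x0W] : 0 < #|c @: W| by apply: leq_trans cW; rewrite double_gt0.
case: (@Order.TotalTheory.arg_maxP _ _ _ x0 (mem (c @: W)) s x0W) => x xW xmax.
have {x0 x0W} [j0 j0W xE] := imsetP xW.
pose low := [pred u | [exists i in W, (c i == u) &&
  [forall j' : 'I_m, (c j' == x) ==> (j' <= i) ==> rel u (d j')]]].
pose high := [pred u | [exists i in W, (c i == u) &&
  [forall j' : 'I_m, (c j' == x) ==> (i <= j') ==> rel u (d j')]]].
have cov : c @: W \subset [set u in low] :|: [set u in high].
  apply/fintype.subsetP => u uW; have [i iW uE] := imsetP uW.
  have sx : (s (c i) <= s (c j0))%O by rewrite -uE -xE; exact: xmax.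
  rewrite !inE; apply/orP.
  by have [H|H] := sep i j0 sx; [left|right]; apply/existsP; exists i;
    rewrite iW uE eqxx /=; apply/forallP => j'; apply/implyP => /eqP cj;
    apply/implyP => ji; apply: H; rewrite -?xE.
have [t1|t2] : t <= #|[set u in low]| \/ t <= #|[set u in high]|.
  have := leq_trans cW (leq_trans (subset_leq_card cov) (leq_card_setU _ _)); lia.
- pose P j := (j \in W) && (c j == x).
  have Pj0 : P j0 by rewrite /P j0W xE eqxx.
  (* Predecessors of the first index of [x] in [W] precede all of [W], since [W] is an interval; so
     every [u] in [low] reaches their ends, which differ by [cdI]. *)
  case: (arg_minnP (fun j : 'I_m => j : nat) Pj0) => j /andP[jW /eqP cj] jmin.
  have [tj _] := Wr _ jW.
  exists [set u in low], (d @: [set i : 'I_m | (i < j) && (c i == c j)]); split => //.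
  + rewrite -setI_eq0; apply/eqP/finset.setP => u; rewrite !inE; apply/negP => /andP[].
    move=> /existsP[i /andP[_ /andP[/eqP <- _]]] /imsetP[k _] /eqP.
    by rewrite (negbTE (cd _ _)).
  + rewrite card_in_imset// => k k'; rewrite !inE => /andP[_ /eqP ck] /andP[_ /eqP ck'].
    by apply: cdI; rewrite ck ck'.
  + move=> a b; rewrite inE => /existsP[i /andP[iW /andP[_ /forallP H]]] /imsetP[k].
    rewrite inE cj => /andP[kj ck] ->; have /implyP/(_ ck)/implyP := H k; apply.
    case: leqP => // ik; have kW : k \in W by apply: Wc iW jW _; rewrite (ltnW ik) ltnW.
    by have := jmin k; rewrite /P kW ck => /(_ isT); rewrite leqNgt kj.
- pose P j := (j \in W) && (c j == x).
  have Pj0 : P j0 by rewrite /P j0W xE eqxx.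
  (* Symmetrically, successors of the last index of [x] in [W] come after all of [W]. *)
  case: (arg_maxnP (fun j : 'I_m => j : nat) Pj0) => j /andP[jW /eqP cj] jmax.
  have [_ tj] := Wr _ jW.
  exists [set u in high], (d @: [set i : 'I_m | (j < i) && (c i == c j)]); split => //.
  + rewrite -setI_eq0; apply/eqP/finset.setP => u; rewrite !inE; apply/negP => /andP[].
    move=> /existsP[i /andP[_ /andP[/eqP <- _]]] /imsetP[k _] /eqP.
    by rewrite (negbTE (cd _ _)).
  + rewrite card_in_imset// => k k'; rewrite !inE => /andP[_ /eqP ck] /andP[_ /eqP ck'].
    by apply: cdI; rewrite ck ck'.
  + move=> a b; rewrite inE => /existsP[i /andP[iW /andP[_ /forallP H]]] /imsetP[k].
    rewrite inE cj => /andP[kj ck] ->; have /implyP/(_ ck)/implyP := H k; apply.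
    case: leqP => // ik; have kW : k \in W by apply: Wc jW iW _; rewrite (ltnW ik) ltnW.
    by have := jmax k; rewrite /P kW ck => /(_ isT) /=; rewrite leqNgt kj.
Qed.

Lemma repeatedPn m (c : 'I_m -> V) t (j : 'I_m) :
  j \notin [set j : 'I_m | #|[set i : 'I_m | (i < j) && (c i == c j)]| < t] ->
  j \notin [set j : 'I_m | #|[set i : 'I_m | (m - i < m - j) && (c i == c j)]| < t] ->
  repeated c t j.
Proof.
rewrite !inE -!leqNgt => H1 H2; split => //.
apply: leq_trans H2 _; apply: subset_leq_card; apply/fintype.subsetP => i.
by rewrite !inE => /andP[h ->]; rewrite andbT; have := ltn_ord i; have := ltn_ord j; lia.
Qed.

End Grids.

(** * Length of a sequence of pairs without a large grid *)

Section CrossBound.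
Local Open Scope nat_scope.
Context {d0 : Order.disp_t} {O : orderType d0} {V : finType}.
Implicit Types (rel : V -> V -> bool) (t m q : nat).

(** At most [4 * t * q] indices fail to be repeated on the left or on the right, so one of
    [4 * t * q + 1] blocks of length [D] avoids them. Its [4 t^2] distinct pairs involve [2 t] left
    ends or [2 t] right ends. *)
Lemma card_sequence_grid rel m (c d : 'I_m -> V) (s : V -> O) (L R : {set V}) t q :
  (forall i j, c i = c j -> d i = d j -> i = j) ->
  (forall i, c i \in L) -> (forall i, d i \in R) -> [disjoint L & R] ->
  (forall i j, (s (c i) <= s (c j))%O ->
    (forall j', c j' = c j -> j' <= i -> rel (c i) (d j')) \/
    (forall j', c j' = c j -> i <= j' -> rel (c i) (d j'))) ->
  (forall i j, (s (d j) <= s (d i))%O ->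
    (forall j', d j' = d j -> j' <= i -> rel (c j') (d i)) \/
    (forall j', d j' = d j -> i <= j' -> rel (c j') (d i))) ->
  0 < t -> 0 < q -> #|L| <= q -> #|R| <= q -> ~ grid rel t ->
  m <= 20 * t ^ 3 * q.
Proof.
move=> cdI cL dR LR sepL sepR t0 q0 Lq Rq noG.
have cd i j : c i != d j.
  by apply/eqP => E; have /(disjointFl LR) := dR j; rewrite -E cL.
rewrite leqNgt; apply/negP => mbig; apply: noG.
pose D := (t.*2) ^ 2; have D0 : 0 < D by rewrite expn_gt0 double_gt0 t0.
(* [4 t^2 (4 t q + 1) <= 20 t^3 q], since [t q >= 1]. *)
have mD : D * (4 * t * q).+1 <= m.
  apply: leq_trans (ltnW mbig); rewrite /D -mul2n expnMn.
  have -> : 20 * t ^ 3 * q = (2 ^ 2 * t ^ 2) * (5 * t * q).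
    by rewrite (expnD t 2 1) expn1; ring.
  have tq : 0 < t * q by rewrite muln_gt0 t0.
  by rewrite leq_mul2l -!mulnA; apply/orP; right; lia.
pose X (c : 'I_m -> V) := [set j : 'I_m | #|[set i : 'I_m | (i < j) && (c i == c j)]| < t]
  :|: [set j : 'I_m | #|[set i : 'I_m | (m - i < m - j) && (c i == c j)]| < t].
have rI : injective (fun i : 'I_m => m - i).
  by move=> i j ij; apply: val_inj => /=; have := ltn_ord i; have := ltn_ord j; lia.
have cX (e : 'I_m -> V) (C : {set V}) :
    (forall j, e j \in C) -> #|C| <= q -> #|X e| <= 2 * t * q.
  move=> eC Cq; apply: leq_trans (leq_card_setU _ _) _.
  apply: (@leq_trans (#|C| * t + #|C| * t)).
    apply: leq_add; first exact: card_few_before t eC (@ord_inj m).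
    exact: card_few_before t eC rI.
  by rewrite addnn -mul2n -mulnA leq_mul2l mulnC leq_mul2l Cq orbT.
(* Indices beyond the last of these blocks default to block 0, which can only rule out more
   blocks. *)
pose blk (j : 'I_m) : 'I_(4 * t * q).+1 := inord (j %/ D).
have [b bN] : exists b, b \notin blk @: (X c :|: X d).
  apply/existsP; rewrite -negb_forall; apply/negP => /forallP H.
  have : #|[set: 'I_(4 * t * q).+1]| <= #|X c :|: X d|.
    apply: leq_trans (leq_imset_card blk _); apply: subset_leq_card.
    by apply/fintype.subsetP => x _; exact: H.
  rewrite cardsT card_ord; apply/negP; rewrite -ltnNge ltnS.
  apply: leq_trans (leq_card_setU _ _) _.
  by have := cX c L cL Lq; have := cX d R dR Rq; lia.
pose W := [set j : 'I_m | j %/ D == b].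
have WX j : j \in W -> j \notin X c :|: X d.
  rewrite inE => /eqP jb; apply: contra bN => jX; apply/imsetP; exists j => //.
  by apply: val_inj; rewrite /= inordK jb.
have WrL j : j \in W -> repeated c t j.
  move=> /WX; rewrite !finset.in_setU !negb_or => /andP[/andP[? ?] _].
  exact: repeatedPn.
have WrR j : j \in W -> repeated d t j.
  move=> /WX; rewrite !finset.in_setU !negb_or => /andP[_ /andP[? ?]].
  exact: repeatedPn.
have Wc (i j k : 'I_m) : i \in W -> k \in W -> i <= j <= k -> j \in W.
  rewrite !inE => /eqP ib /eqP kb /andP[ij jk].
  by rewrite eqn_leq -{1}kb -ib !leq_div2r.
have DW : D <= #|W|.
  have bm (i : 'I_D) : b * D + i < m.
    have : b * D + D <= m.
      by apply: leq_trans mD; rewrite -mulSnr mulnC leq_mul2l ltn_ord orbT.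
    by have := ltn_ord i; lia.
  rewrite -[D]card_ord -cardsT -(@card_imset _ _ (fun i => Ordinal (bm i))); last first.
    by move=> i j /(congr1 val) /= /addnI /val_inj.
  apply: subset_leq_card; apply/fintype.subsetP => _ /imsetP[i _ ->].
  by rewrite inE /= divnMDl// divn_small ?addn0.
have Wcd : #|W| <= #|c @: W| * #|d @: W|.
  have pI : injective (fun j => (c j, d j)) by move=> i j [ci di]; exact: cdI.
  rewrite -(card_imset _ pI) -cardsX; apply: subset_leq_card.
  by apply/fintype.subsetP => _ /imsetP[j jW ->]; rewrite inE /= !imset_f.
have [cW|dW] : t.*2 <= #|c @: W| \/ t.*2 <= #|d @: W|.
  by move: (leq_trans DW Wcd); rewrite /D; nia.
- exact: (window_grid cdI cd Wc WrL sepL t0 cW).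
(* With the sides swapped, the relation is transposed and the order dual: the extremal right end has
   the smallest [s]. *)
- have [A [B [AB At Bt H]]] : grid (fun a b => rel b a) t.
    apply: (@window_grid _ O^d V _ _ d c s W _ _ _ Wc WrR _ t0 dW).
    + by move=> i j di ci; exact: cdI.
    + by move=> i j; rewrite eq_sym.
    + by move=> i j; exact: sepR.
  by exists B, A; split => //; [rewrite disjoint_sym|move=> x y ? ?; exact: H].
Qed.

End CrossBound.

(** * Paths crossing a vertical line *)

Section PlanarReachability.
Context {R : realType} {V : finType}.
Variables (c : R) (F : set (R * R)) (pos : V -> R * R) (t : nat).

Definition reachb (u w : V) : bool := `[< reach c F (pos u) (pos w) >].

(** The vertical line through the rightmost point of [A] weakly separates [A] from [B]. The pairs
    are ranked by the height at which one chosen path crosses it. *)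
Lemma card_crossing_pairs (A B : {set V}) (q : nat) :
  [disjoint A & B] ->
  (forall u w, u \in A -> w \in B -> (pos u).1 <= (pos w).1) ->
  (0 < t)%N -> (#|A| <= q)%N -> (#|B| <= q)%N -> ~ grid reachb t ->
  (#|[set e : V * V | [&& e.1 \in A, e.2 \in B & reachb e.1 e.2]]|
    <= 20 * t ^ 3 * q)%N.
Proof.
move=> AB posAB t0 Aq Bq noG; set X := [set e | _].
have [->|[e0]] := set_0Vmem X; first by rewrite cards0.
rewrite inE => /and3P[e1 e2 _].
have q0 : (0 < q)%N by apply: leq_trans Aq; apply/card_gt0P; exists e0.1.
case: (@arg_maxP _ R V e0.1 (mem A) (fun u => (pos u).1) e1) => u0 u0A.
set l := (pos u0).1 => u0max.
have lA u : u \in A -> (pos u).1 <= l by exact: u0max.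
have lB w : w \in B -> l <= (pos w).1 by exact: posAB.
have /choice[g gP] : forall e : V * V, exists g, reachb e.1 e.2 ->
    graph_path c F (pos e.1) (pos e.2) g.
  by move=> e; have [/asboolP[g ?]|_] := boolP (reachb e.1 e.2); [exists g|exists id].
pose h e := g e l.
pose es := sort (relpre h <=%O) (enum X).
have es_size : size es = #|X| by rewrite size_sort cardE.
have esX (i : 'I_#|X|) : nth e0 es i \in X.
  by rewrite -mem_enum -(mem_sort (relpre h <=%O)) mem_nth// es_size.
have es_le (i j : 'I_#|X|) : (i <= j)%N -> h (nth e0 es i) <= h (nth e0 es j).
  move=> ij; apply: (@sorted_leq_nth _ (relpre h <=%O)) => //.
  - by move=> x y z /=; exact: le_trans.
  - by move=> x /=.
  - by apply: sort_sorted => x y; exact: le_total.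
  - by rewrite inE es_size.
  - by rewrite inE es_size.
pose a (i : 'I_#|X|) := (nth e0 es i).1; pose b (i : 'I_#|X|) := (nth e0 es i).2.
have aA i : a i \in A by have := esX i; rewrite inE => /and3P[].
have bB i : b i \in B by have := esX i; rewrite inE => /and3P[].
have gP' i : graph_path c F (pos (a i)) (pos (b i)) (g (nth e0 es i)).
  by apply: gP; have := esX i; rewrite inE => /and3P[].
have h_at (i j : 'I_#|X|) : (i <= j)%N ->
    g (nth e0 es i) l <= g (nth e0 es j) l by exact: es_le.
have span i : (pos (a i)).1 <= l <= (pos (b i)).1 by rewrite lA ?lB.
apply: (@card_sequence_grid _ R V reachb #|X| a b (fun u => (pos u).1) A B t q) => //.
- move=> i j aij bij; apply: val_inj; apply/eqP.
  have es_uniq : uniq es by rewrite sort_uniq enum_uniq.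
  have lt_es (k : 'I_#|X|) : (k < size es)%N by rewrite es_size.
  rewrite -(nth_uniq e0 (lt_es i) (lt_es j) es_uniq) [nth e0 es i]surjective_pairing.
  by rewrite [nth e0 es j]surjective_pairing -/(a i) -/(b i) aij bij.
(* If path [i] passes below [a j], it starts under every path from there and is above those of
   smaller rank at the line, so it meets them. The other case is symmetric. *)
- move=> i j sij; have /andP[aj bj] := span j; have /andP[ai bi] := span i.
  have [below|above] := lerP (g (nth e0 es i) (pos (a j)).1) (pos (a j)).2;
    [left|right] => j' ajj' le_j'; have [_ _ + _ _] := gP' j';
    have /andP[_ bj'] := span j'; rewrite ajj' => gj'; apply/asboolP.
    apply: (reach_cross (gP' i) (gP' j') (s := (pos (a j)).1) (t := l));
      rewrite ?ajj' ?gj' ?lexx ?sij ?aj ?ai ?bi ?bj' ?(le_trans aj)//.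
    exact: h_at.
  apply: (reach_cross (gP' i) (gP' j') (s := l) (t := (pos (a j)).1));
    rewrite ?ajj' ?gj' ?lexx ?sij ?aj ?ai ?bi ?bj' ?(le_trans aj) ?(ltW above)//.
  exact: h_at.
(* Here the meeting point lies between the line and [b j]: a path towards [b j] is left there for
   path [i]. *)
- move=> i j sij; have /andP[aj bj] := span j; have /andP[ai bi] := span i.
  have [below|above] := lerP (g (nth e0 es i) (pos (b j)).1) (pos (b j)).2;
    [left|right] => j' bjj' le_j'; have [_ _ _ + _] := gP' j';
    have /andP[aj' _] := span j'; rewrite bjj' => gj'; apply/asboolP.
    apply: (reach_cross (gP' j') (gP' i) (s := l) (t := (pos (b j)).1));
      rewrite ?bjj' ?gj' ?lexx ?sij ?bj ?ai ?bi ?aj' ?(le_trans _ bj)//.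
    exact: h_at.
  apply: (reach_cross (gP' j') (gP' i) (s := (pos (b j)).1) (t := l));
    rewrite ?bjj' ?gj' ?lexx ?sij ?bj ?ai ?bi ?aj' ?(le_trans _ bj) ?(ltW above)//.
  exact: h_at.
Qed.

End PlanarReachability.

(** * Sparsity of one class *)

(** A minimal remaining element is added at each step. Prescribing the size instead of a threshold
    for [s] copes with ties. *)
Lemma exists_lower_subset {d : Order.disp_t} {O : orderType d} {V : finType}
    (s : V -> O) (A : {set V}) (q : nat) : (q <= #|A|)%N ->
  exists B : {set V}, [/\ B \subset A, #|B| = q &
    forall u w, u \in B -> w \in A :\: B -> (s u <= s w)%O].
Proof.
elim: q => [|q IHq] qA.
  by exists finset.set0; rewrite finset.sub0set cards0; split => // u w; rewrite inE.
have [B [BA Bq Bmin]] := IHq (ltnW qA).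
have /card_gt0P[x0 x0A] : (0 < #|A :\: B|)%N by rewrite cardsDS// Bq subn_gt0.
case: (@arg_minP _ O V x0 (mem (A :\: B)) s x0A) => x xAB xmin.
have /setDP[xA xB] : x \in A :\: B by [].
exists (x |: B); split.
- by rewrite finset.subUset finset.sub1set xA BA.
- by rewrite cardsU1 xB Bq.
move=> u w; rewrite !inE negb_or -andbA => /predU1P[->|uB] /and3P[wx wB wA].
  by apply: xmin; apply/setDP.
by apply: Bmin; rewrite // inE wB.
Qed.

(** Halving [A] from left to right gives [T (p + 1) <= 2 T p + 20 t^3 2^p], the last term counting
    pairs across the cut. *)
Lemma card_reach_pairs {R : realType} {V : finType} (c : R) (F : set (R * R))
    (pos : V -> R * R) (t p : nat) (A : {set V}) :
  injective pos -> (0 < t)%N -> ~ grid (reachb c F pos) t -> (#|A| <= 2 ^ p)%N ->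
  (#|[set e : V * V | [&& e.1 \in A, e.2 \in A, e.1 != e.2
                        & reachb c F pos e.1 e.2]]| <= p * (20 * t ^ 3) * 2 ^ p)%N.
Proof.
move=> posI t0 noG; pose pairs (A : {set V}) := [set e : V * V | [&& e.1 \in A, e.2 \in A,
  e.1 != e.2 & reachb c F pos e.1 e.2]].
rewrite -/(pairs A); set M := (20 * t ^ 3)%N; elim: p A => [|p IHp] A Ap.
  rewrite !mul0n leqn0 cards_eq0; apply/eqP/finset.setP => e; rewrite !inE.
  apply/negP => /and4P[e1 e2 /eqP e12 _]; apply: e12.
  by have /card_le1_eqP := Ap; exact.
pose q := minn #|A| (2 ^ p).
have [B [BA Bq Blow]] := exists_lower_subset (fun u => (pos u).1) (geq_minl #|A| (2 ^ p)).
have Bp : (#|B| <= 2 ^ p)%N by rewrite Bq geq_minr.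
have Cp : (#|A :\: B| <= 2 ^ p)%N.
  by rewrite cardsDS// Bq /q; move: Ap; rewrite expnS; lia.
pose X := [set e : V * V | [&& e.1 \in B, e.2 \in A :\: B & reachb c F pos e.1 e.2]].
have cover : pairs A \subset pairs B :|: pairs (A :\: B) :|: X.
  apply/fintype.subsetP => -[u w]; rewrite !inE /= => /and4P[uA wA uw ruw].
  rewrite uA wA uw ruw !andbT /=.
  have [uB|uB] := boolP (u \in B); have [wB|wB] := boolP (w \in B) => //=.
  (* A pair directed from the right part to [B] would have equal first coordinates; a graph has only
     one height there, so its points would coincide. *)
  have wu : (pos w).1 <= (pos u).1 by apply: Blow; rewrite // inE uB.
  have /asboolP[g [uw' _ gu gw _]] := ruw.
  case/eqP: uw; apply: posI; have E : (pos u).1 = (pos w).1 by apply/le_anti/andP.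
  by rewrite [pos u]surjective_pairing [pos w]surjective_pairing -gu -gw E.
have XB : (#|X| <= M * 2 ^ p)%N.
  apply: card_crossing_pairs => //.
  by rewrite -setI_eq0; apply/eqP/finset.setP => u; rewrite !inE; case: (u \in B).
apply: leq_trans (subset_leq_card cover) _.
apply: leq_trans (leq_card_setU _ _) _.
apply: leq_trans (leq_add (leq_card_setU _ _) XB) _.
apply: leq_trans (leq_add (leq_add (IHp _ Bp) (IHp _ Cp)) (leqnn _)) _.
clearbody M; rewrite expnS -!mulnA (mulnCA M); set N := (M * 2 ^ p)%N.
by clearbody N; nia.
Qed.

(** * A graph without large bipartite patterns *)

Section RamseyGraph.
Local Open Scope nat_scope.
Context {V : finType}.
Implicit Types (G : {set {set V}}) (t : nat).

(** Edges are the two-element members of [G]. Letting [G] be any set of vertex sets turns graph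
    complement into set complement and makes counting a matter of powersets. *)
Definition edge_rel G (u w : V) : bool := (u != w) && ([set u; w] \in G).

Lemma edge_rel_sym G : symmetric (edge_rel G).
Proof. by move=> u w; rewrite /edge_rel eq_sym finset.setUC. Qed.

Lemma edge_rel_irr G : irreflexive (edge_rel G).
Proof. by move=> u; rewrite /edge_rel eqxx. Qed.

Lemma card_edge_relC G :
  #|[set e : V * V | edge_rel G e.1 e.2]| +
  #|[set e : V * V | edge_rel (~: G) e.1 e.2]| = #|V| * #|V|.-1.
Proof.
set X := [set e | _]; set Y := [set e | _].
have XY : [disjoint X & Y].
  rewrite -setI_eq0; apply/eqP/finset.setP => e; rewrite !inE /edge_rel !inE.
  by case: (_ \in G); rewrite ?andbF.
have XYD : X :|: Y = ~: [set (u, u) | u in V].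
  apply/finset.setP => -[u w]; rewrite !inE /edge_rel !inE /= -andb_orr orbN andbT.
  congr (~~ _); apply/eqP/imsetP => [->|[x _ [-> ->]]] //; by exists w.
have := leq_card_setU X Y; rewrite XY => /leqif_refl; rewrite ?eqxx => H.
have <- : #|X :|: Y| = #|X| + #|Y| by apply/eqP; rewrite (leq_card_setU X Y).
rewrite XYD cardsCs finset.setCK card_imset; last by move=> u w [].
by rewrite card_prod; case: #|V| => // n; rewrite mulnS /= addKn.
Qed.

(** A copy of [K_(t,t)] is named by two sequences of vertices, so there are at most [(#|V| ^ t) ^ 2]
    of them. *)
Definition bipartite_edges t (f : {ffun 'I_t -> V} * {ffun 'I_t -> V}) : {set {set V}} :=
  [set [set f.1 ij.1; f.2 ij.2] | ij in [set: 'I_t * 'I_t]].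

Definition is_bipartite_pattern t (f : {ffun 'I_t -> V} * {ffun 'I_t -> V}) : bool :=
  [&& injectiveb f.1, injectiveb f.2 & [forall i, forall j, f.1 i != f.2 j]].

Lemma card_bipartite_edges t f :
  @is_bipartite_pattern t f -> #|bipartite_edges f| = t ^ 2.
Proof.
move=> /and3P[/injectiveP I1 /injectiveP I2 /forallP f12].
rewrite card_imset ?cardsT ?card_prod ?card_ord// => -[i j] [i' j'] /= E.
have N i0 j0 : f.1 i0 != f.2 j0 by have /forallP := f12 i0; exact.
have : f.1 i \in [set f.1 i'; f.2 j'] by rewrite -E !inE eqxx.
have : f.2 j \in [set f.1 i'; f.2 j'] by rewrite -E !inE eqxx orbT.
rewrite !inE (negbTE (N _ _)) orbF eq_sym (negbTE (N _ _)) /= => /eqP/I2 -> /eqP/I1 ->.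
by [].
Qed.

Lemma grid_pattern G t : grid (edge_rel G) t ->
  exists2 f, @is_bipartite_pattern t f & bipartite_edges f \subset G.
Proof.
move=> [A [B [AB tA tB H]]].
exists ([ffun i => enum_val (widen_ord tA i)], [ffun i => enum_val (widen_ord tB i)]).
  apply/and3P; split.
  - by apply/injectiveP => i j; rewrite !ffunE => /enum_val_inj/(congr1 val)/= /val_inj.
  - by apply/injectiveP => i j; rewrite !ffunE => /enum_val_inj/(congr1 val)/= /val_inj.
  - apply/forallP => i; apply/forallP => j; rewrite !ffunE; apply/eqP => E.
    by have /(disjointFr AB) := enum_valP (widen_ord tA i); rewrite E enum_valP.
apply/fintype.subsetP => _ /imsetP[[i j] _ ->]; rewrite !ffunE.
by have /andP[] := H _ _ (enum_valP (widen_ord tA i)) (enum_valP (widen_ord tB j)).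
Qed.

Lemma leq_card_bigcup (I T : finType) (P : {pred I}) (X : I -> {set T}) n :
  (forall i, P i -> #|X i| <= n) -> #|\bigcup_(i | P i) X i| <= #|I| * n.
Proof.
move=> Xn; apply: (@leq_trans (\sum_(i | P i) #|X i|)).
  elim/big_rec2: _ => [|i m S Pi Sm]; first by rewrite cards0.
  by apply: leq_trans (leq_card_setU _ _) _; rewrite leq_add2l.
rewrite -sum_nat_const big_mkcond; apply: leq_sum => i _.
by case: ifP => // /Xn.
Qed.

(** Union bound: with [N = #|{set V}|], a pattern fixes [t ^ 2] memberships and so lies in [G] or in
    [~: G] for at most [2 * 2 ^ (N - t ^ 2)] of the [2 ^ N] sets [G]. *)
Lemma exists_grid_free t : 0 < t -> (#|V| ^ t) ^ 2 * 2 < 2 ^ (t ^ 2) ->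
  exists G, ~ grid (edge_rel G) t /\ ~ grid (edge_rel (~: G)) t.
Proof.
move=> t0 Vt; apply: contrapT => H.
pose bad f := [set G : {set {set V}} | (@bipartite_edges t f \subset G)
                              || (bipartite_edges f \subset ~: G)].
have cover : [set: {set {set V}}] \subset \bigcup_(f | @is_bipartite_pattern t f) bad f.
  apply/fintype.subsetP => G _; apply/bigcupP.
  have [gG|gG] : grid (edge_rel G) t \/ grid (edge_rel (~: G)) t.
    have [g1|g1] := pselect (grid (edge_rel G) t); [by left|right].
    by apply: contrapT => g2; apply: H; exists G.
  - by have [f fP fG] := grid_pattern gG; exists f; rewrite // inE fG.
  - by have [f fP fG] := grid_pattern gG; exists f; rewrite // inE fG orbT.
have badn f : is_bipartite_pattern f -> #|bad f| <= 2 * 2 ^ (#|{set V}| - t ^ 2).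
  move=> fP; set Q := bipartite_edges f.
  have QC : #|~: Q| = #|{set V}| - t ^ 2.
    by rewrite cardsCs finset.setCK (card_bipartite_edges fP).
  have sub : bad f \subset powerset (~: Q) :|: [set ~: G | G in powerset (~: Q)].
    apply/fintype.subsetP => G; rewrite !inE => /orP[QG|QG].
      apply/orP; right; apply/imsetP; exists (~: G); last by rewrite finset.setCK.
      by rewrite inE finset.setCS.
    by apply/orP; left; rewrite -finset.setCS finset.setCK.
  apply: leq_trans (subset_leq_card sub) _; apply: leq_trans (leq_card_setU _ _) _.
  by rewrite card_imset ?card_powerset ?QC ?addnn ?mul2n//; exact: finset.setC_inj.
have := leq_trans (subset_leq_card cover) (leq_card_bigcup badn).
rewrite cardsT -[#|{set {set V}}|]cardsT -powersetT card_powerset cardsT.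
rewrite card_prod card_ffun card_ord => big.
(* Some pattern must account for the empty [G]; its size shows that the truncated subtraction is
   exact. *)
have tT : t ^ 2 <= #|{set V}|.
  have /fintype.subsetP/(_ finset.set0) := cover.
  rewrite inE => /(_ isT)/bigcupP[f fP _].
  by rewrite -(card_bipartite_edges fP) max_card.
move: big; apply/negP; rewrite -ltnNge mulnA.
have -> : 2 ^ #|{set V}| = 2 ^ (t ^ 2) * 2 ^ (#|{set V}| - t ^ 2).
  by rewrite -expnD subnKC.
by rewrite ltn_pmul2r ?expn_gt0// mulnn.
Qed.

End RamseyGraph.

(** For [t = 2 p + 2] the union bound reads [2 p t + 1 < t ^ 2]. The denser of the graph and its
    complement has at least half of the ordered pairs. *)
Lemma exists_dense_grid_free (p : nat) : exists E : rel 'I_(2 ^ p),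
  [/\ symmetric E, irreflexive E, ~ grid E (p.*2.+2) &
      (2 ^ p * (2 ^ p).-1 <= 2 * #|[set e : 'I_(2 ^ p) * 'I_(2 ^ p) | E e.1 e.2]|)%N].
Proof.
have [|G [G1 G2]] := @exists_grid_free 'I_(2 ^ p) p.*2.+2 isT.
  rewrite card_ord -!expnM -[X in (_ * X)%N]expn1 -expnD ltn_exp2l//; lia.
have := card_edge_relC G; rewrite card_ord => sumG.
have [big|big] := leqP #|[set e : 'I_(2 ^ p) * 'I_(2 ^ p) | edge_rel (~: G) e.1 e.2]|
                        #|[set e : 'I_(2 ^ p) * 'I_(2 ^ p) | edge_rel G e.1 e.2]|.
  exists (edge_rel G); split => //; [exact: edge_rel_sym|exact: edge_rel_irr|].
  by rewrite -sumG mul2n -addnn leq_add2l.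
exists (edge_rel (~: G)); split => //; [exact: edge_rel_sym|exact: edge_rel_irr|].
by rewrite -sumG mul2n -addnn leq_add2r ltnW.
Qed.

(** * Conclusion *)

(** Every edge has a geodesic in one of the [2 k] sectors, and reachability in a sector implies
    adjacency, so each class inherits from [E] the absence of grids. *)
Lemma card_edges_obstacle_representation {R : realType} {k p t : nat} {V : finType}
    {E : rel V} :
  (1 < k)%N -> irreflexive E -> (0 < t)%N -> (#|V| <= 2 ^ p)%N ->
  has_obstacle_representation R k E -> ~ grid E t ->
  (#|[set e : V * V | E e.1 e.2]| <= 2 * k * (p * (20 * t ^ 3) * 2 ^ p))%N.
Proof.
move=> k1 Eirr t0 Vp [phi [S [phiI _ rep]]] noG.
set B := (\bigcup_(O in S) O)%classic in rep.
pose pos (i : nat) u := rotate (sector_axis k i) (phi u).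
pose rb (i : nat) := reachb (sector_slope k) (free_region k i B) (pos i).
have posI i : injective (pos i).
  by move=> u w /(can_inj (rotateK _)) /phiI.
have rbE (i : 'I_(2 * k)) u w : u != w -> rb i u w -> E u w.
  move=> uw /asboolP /(reach_monotone k1)[f [fc fm f0 f1 fB]].
  by apply/rep => //; exists f; split => //; split => //; exists i.
have noG' (i : 'I_(2 * k)) : ~ grid (rb i) t.
  move=> [X [Y [XY Xt Yt H]]]; apply: noG; exists X, Y; split => // a b aX bY.
  apply: (rbE i); last exact: H.
  by apply/eqP => ab; have := disjointFr XY aX; rewrite ab bY.
pose pairs (i : 'I_(2 * k)) := [set e : V * V | [&& e.1 \in [set: V], e.2 \in [set: V],
  e.1 != e.2 & rb i e.1 e.2]].
have cover : [set e : V * V | E e.1 e.2] \subset \bigcup_(i | true) pairs i.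
  apply/fintype.subsetP => -[u w]; rewrite inE /= => Euw.
  have uw : u != w by apply/eqP => uw; move: Euw; rewrite uw Eirr.
  have [f [[fc [i fm]] f0 f1 fB]] := (rep u w uw).1 Euw.
  apply/bigcupP; exists i => //; rewrite !inE /= uw; apply/asboolP.
  by rewrite /pos -f0 -f1; exact: monotone_reach.
apply: leq_trans (subset_leq_card cover) _.
rewrite -[X in (_ <= X * _)%N]card_ord; apply: leq_card_bigcup => i _.
by apply: card_reach_pairs (@posI i) t0 (noG' i) _; rewrite cardsT.
Qed.

(* For [N >= 1 / eps] and [n = 2 ^ p], this gives [n ^ eps >= 2 ^ r], which beats the
polylogarithmic factor [160 p t^3]. *)
Lemma exists_scale (N : nat) : exists r p : nat,
  [/\ (N <= r)%N, (N * r <= p)%N, (0 < p)%N &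
      (160 * p * (p.*2.+2) ^ 3 <= 2 ^ r)%N].
Proof.
(* [p / r = 2 ^ N] exceeds [N], and the last bound follows from [2 ^ 14 * p ^ 4 = 2 ^ (8 N + 46)]
   and [8 N + 46 <= r]. *)
exists (2 ^ (N + 8))%N, (2 ^ (2 * N + 8))%N.
have N2 : (N < 2 ^ N)%N by exact: ltn_expl.
have r0 : (0 < 2 ^ (2 * N + 8))%N by rewrite expn_gt0.
split => //.
- by apply: leq_trans (ltnW N2) _; rewrite leq_exp2l// leq_addr.
- by rewrite mul2n -addnn -addnA [(2 ^ (N + (N + 8)))%N]expnD leq_mul2r (ltnW N2) orbT.
set p := (2 ^ (2 * N + 8))%N in r0 *.
apply: (@leq_trans (2 ^ 14 * p ^ 4)).
  apply: (@leq_trans (160 * p * (4 * p) ^ 3)).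
    by rewrite leq_mul2l leq_exp2r//; apply/orP; right; lia.
  have -> : (160 * p * (4 * p) ^ 3 = 10240 * p ^ 4)%N by clearbody p; ring.
  by rewrite leq_mul2r; apply/orP; right.
rewrite /p -expnM -expnD leq_exp2l// expnD.
by move: (2 ^ N)%N N2 => M; lia.
Qed.

Theorem theorem3 (R : realType) (eps : R) (eps_gt0 : 0 < eps) (N : nat) :
  exists (V : finType) (E : rel V),
    [/\ symmetric E, irreflexive E, (N <= #|V|)%N &
        forall k : nat, (2 <= k)%N ->
          k%:R < #|V|%:R `^ (1 - eps) ->
          ~ has_obstacle_representation R k E].
Proof.
(* [M >= 1 / eps] and [M r <= p] yield [r <= p eps], that is [2 ^ r <= n ^ eps] for [n = 2 ^ p]. *)
pose M := maxn N (Num.truncn eps^-1).+1.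
have [r [p [Mr Mrp p0 scale]]] := exists_scale M.
have [E [Esym Eirr Egrid Edense]] := exists_dense_grid_free p.
exists 'I_(2 ^ p), E; split => //.
  rewrite card_ord; apply: leq_trans (ltnW (ltn_expl p _)) => //.
  apply: leq_trans (leq_maxl N _) _; apply: leq_trans Mrp.
  by apply: leq_pmulr; apply: leq_trans Mr; rewrite leq_max orbT.
move=> k k1; rewrite card_ord => kn rep.
have : (k * 2 ^ r < 2 ^ p)%N.
  have n1 : (1 : R) <= (2 ^ p)%:R by rewrite ler1n expn_gt0.
  rewrite -(ltr_nat R) natrM.
  apply: (@lt_le_trans _ _ ((2 ^ p)%:R `^ (1 - eps) * (2 ^ r)%:R)).
    by rewrite ltr_pM2r// ltr0n expn_gt0.
  have nE : (2 ^ p)%:R = (2 ^ p)%:R `^ (1 - eps) * (2 ^ p)%:R `^ eps :> R.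
    by rewrite -powRD ?subrK ?powRr1// implybE (gt_eqF (lt_le_trans ltr01 n1)) orbT.
  rewrite [leRHS]nE; apply: ler_wpM2l; first exact: powR_ge0.
  rewrite !natrX -powR_mulrn// -[in leRHS]powR_mulrn// -powRrM.
  apply: ler_powR; first by rewrite ler1n.
  have Me : 1 <= M%:R * eps.
    rewrite -ler_pdivrMr// div1r; apply: (@le_trans _ _ (Num.truncn eps^-1).+1%:R).
      by apply: ltW; apply: truncnS_gt.
    by rewrite ler_nat leq_maxr.
  apply: (@le_trans _ _ ((M * r)%:R * eps)); last by rewrite ler_pM2r// ler_nat.
  by rewrite natrM mulrAC ler_peMl.
apply/negP; rewrite -leqNgt.
have := card_edges_obstacle_representation k1 Eirr (ltn0Sn p.*2.+1)
  (eq_leq (card_ord _)) rep Egrid.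
have n2 : (2 <= 2 ^ p)%N by rewrite -{1}[2%N]expn1 leq_exp2l.
move: Edense; set X := #|_|; set T := (p.*2.+2 ^ 3)%N in scale *; move=> Edense Xle.
(* A factor [2 ^ p] cancels between the lower and the upper bound on the number of edges. *)
have : ((2 ^ p).-1 <= 2 * (2 * k * (p * (20 * T))))%N.
  have := leq_trans Edense (leq_mul (leqnn 2) Xle).
  rewrite !mulnA [X in (X <= _)%N]mulnC leq_mul2r; case/orP => // /eqP n0.
  by rewrite n0 in n2.
have : (k * (160 * p * T) <= k * 2 ^ r)%N by rewrite leq_mul2l scale orbT.
have -> : (2 * (2 * k * (p * (20 * T))) = 80 * (k * p * T))%N by ring.
have -> : (k * (160 * p * T) = 160 * (k * p * T))%N by ring.
(* From [n - 1 <= 80 x], [160 x <= k m] and [n >= 2] follows [n <= 2 (n - 1) <= k m]. *)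
move: n2; move: (2 ^ p)%N (2 ^ r)%N (k * p * T)%N => n m x; lia.
Qed.
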